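(* Let $\mathbf A=(A_1,\dots,A_k)$ be a $k$-sorted set with every $A_i$ finite, and let $\Gamma$ be a set of relations on $\mathbf A$ of arity at most $m\in\mathbb N$ such that $\mathrm{Pol}(\Gamma)\not\sim\mathcal T$. Then there exist $l\in\mathbb N$, an $l$-sorted set $\mathbf B=(B_1,\dots,B_l)$ and a set $\Delta$ of relations on $\mathbf B$ of arity at most $m$ such that: $\mathrm{Pol}(\Gamma)\sim\mathrm{Pol}_{\mathrm{id}}(\Delta)=\mathrm{Pol}(\Delta)$; $1<|B_i|\le\max_{j\in[k]}|A_j|$ for every $i\in[l]$; and if every relation in $\Gamma$ has small projections, then so does every relation in $\Delta$.
   Context: An $n$-ary operation on a $k$-sorted set $\mathbf A$ is a tuple $(f_1,\dots,f_k)$ with $f_i:A_i^n\to A_i$; it is idempotent if each $f_i(a,\dots,a)=a$. A relation on $\mathbf A$ of type $(i_1,\dots,i_r)$ ($i_j\in[k]$) is a subset $R\subseteq A_{i_1}\times\dots\times A_{i_r}$ together with its type; its arity is $r$; $\mathbf f$ preserves $R$ if applying $f_{i_j}$ in row $j$ to any $n$ columns from $R$ gives a tuple in $R$. $\mathrm{Pol}(\Gamma)$ is the set of all operations preserving every relation of $\Gamma$, and $\mathrm{Pol}_{\mathrm{id}}(\Gamma)$ its subset of idempotent operations. A relation has small projections if each of its projections onto a coordinate has at most two elements. These sets are minions with minors $f_i^{(\alpha)}(a_1,\dots,a_p)=f_i(a_{\alpha(1)},\dots,a_{\alpha(n)})$; $\mathcal M\sim\mathcal N$ means there are minion homomorphisms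 (arity-preserving maps commuting with minors) in both directions. $\mathcal T$ is the clone of all operations on a one-element set. *)

(* Defs.v *)
From mathcomp Require Import all_boot.

Set Implicit Arguments.
Unset Strict Implicit.
Unset Printing Implicit Defensive.

(* A finite k-sorted set is a family [A : 'I_k -> finType]; an n-ary operation
   on it is a k-tuple of functions A_i^n -> A_i. Finite functions are used
   throughout so that Leibniz equality is extensional. *)
Definition op (k : nat) (A : 'I_k -> finType) (n : nat) : Type :=
  {dffun forall i : 'I_k, {ffun {ffun 'I_n -> A i} -> A i}}.

Definition idempotent_op (k : nat) (A : 'I_k -> finType) (n : nat)
    (f : op A n) : Prop :=
  forall (i : 'I_k) (a : A i), f i [ffun _ : 'I_n => a] = a.

Definition minor (k : nat) (A : 'I_k -> finType) (n p : nat)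
    (alpha : 'I_n -> 'I_p) (f : op A n) : op A p :=
  [ffun i : 'I_k => [ffun a : {ffun 'I_p -> A i} =>
    f i [ffun j : 'I_n => a (alpha j)]]].

Record relation (k : nat) (A : 'I_k -> finType) : Type := Relation {
  arity : nat;
  rtype : 'I_arity -> 'I_k;
  tuples : {set {dffun forall j : 'I_arity, A (rtype j)}}
}.

Definition preserves (k : nat) (A : 'I_k -> finType) (n : nat)
    (f : op A n) (R : relation A) : Prop :=
  forall t : 'I_n -> {dffun forall j : 'I_(arity R), A (rtype j)},
    (forall c : 'I_n, t c \in tuples R) ->
    [ffun j : 'I_(arity R) => f (rtype j) [ffun c : 'I_n => t c j]]
      \in tuples R.

Definition small_projections (k : nat) (A : 'I_k -> finType)
    (R : relation A) : Prop :=
  forall j : 'I_(arity R),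
    #|[set (t : {dffun forall j : 'I_(arity R), A (rtype j)}) j
        | t in tuples R]| <= 2.

(* Operations in a minion have arity at least 1: level [n] of an operation set
   consists of operations of arity n.+1. *)
Definition op_set (k : nat) (A : 'I_k -> finType) : Type :=
  forall n : nat, op A n.+1 -> Prop.

Definition Pol (k : nat) (A : 'I_k -> finType) (G : relation A -> Prop) :
    op_set A :=
  fun n f => forall R : relation A, G R -> preserves f R.

Definition Pol_id (k : nat) (A : 'I_k -> finType) (G : relation A -> Prop) :
    op_set A :=
  fun n f => Pol G f /\ idempotent_op f.

(* The clone of all operations on a one-element set. *)
Definition trivial_clone : op_set (fun _ : 'I_1 => unit : finType) :=
  fun n f => True.

(* A minion homomorphism M -> N is given by total maps whose values matter on
   M only. This loses nothing: [op B n.+1] always contains the projections, so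
   any map defined on M extends. *)
Definition minion_hom (k l : nat) (A : 'I_k -> finType) (B : 'I_l -> finType)
    (M : op_set A) (N : op_set B) : Prop :=
  exists phi : forall n : nat, op A n.+1 -> op B n.+1,
    (forall (n : nat) (f : op A n.+1), M n f -> N n (phi n f)) /\
    (forall (n p : nat) (alpha : 'I_n.+1 -> 'I_p.+1) (f : op A n.+1),
       M n f -> phi p (minor alpha f) = minor alpha (phi n f)).

Definition minion_equiv (k l : nat) (A : 'I_k -> finType)
    (B : 'I_l -> finType) (M : op_set A) (N : op_set B) : Prop :=
  minion_hom M N /\ minion_hom N M.

(* Main.v *)
(* Take a unary polymorphism [e] whose images are as small as possible: every
   unary polymorphism is then injective on the image of [e], so after
   restricting to the image, each polymorphism [f] can be made idempotent by composing it
   with the inverse of the permutation x |-> f(x, ..., x), an operation that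
   commutes with minors. Adding the singleton unary relations to the restricted
   relations then forces idempotence. Sorts on which [e] is constant become free
   two-element sorts; some other sort exists, as otherwise constants would be
   polymorphisms. *)
Require Import Defs.
From mathcomp Require Import all_boot.
From Stdlib Require Import Classical.

Set Implicit Arguments.
Unset Strict Implicit.
Unset Printing Implicit Defensive.

Lemma in_set_eq (T : finType) (S : {set T}) (x y : T) :
  x \in S -> x = y -> y \in S.
Proof. by move=> xS <-. Qed.

(** * Operations, minors and unary polymorphisms *)

Section Operations.

Variables (k : nat) (A : 'I_k -> finType).

Definition compose n (u : op A 1) (f : op A n) : op A n :=
  [ffun i => [ffun a : {ffun 'I_n -> A i} => u i [ffun _ => f i a]]].

Definition diag n (f : op A n) : op A 1 := minor (fun _ => ord0) f.

Definition unary (u : op A 1) (i : 'I_k) (x : A i) : A i :=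
  u i [ffun _ => x].

Definition image1 (u : op A 1) (i : 'I_k) : {set A i} :=
  [set unary u x | x : A i].

Definition singleton_rel (i : 'I_k) (a : A i) : relation A :=
  @Relation k A 1 (fun _ => i)
    [set t : {dffun forall j : 'I_1, A i} | t ord0 == a].

Lemma composeE n u (f : op A n) i a : compose u f i a = unary u (f i a).
Proof. by rewrite !ffunE. Qed.

Lemma minorE n p (alpha : 'I_n -> 'I_p) (f : op A n) i a :
  minor alpha f i a = f i [ffun j => a (alpha j)].
Proof. by rewrite !ffunE. Qed.

Lemma op_ext n (f g : op A n) : (forall i a, f i a = g i a) -> f = g.
Proof. by move=> eq_fg; apply/ffunP => i; apply/ffunP => a. Qed.

Lemma unary_compose u v i x : @unary (compose u v) i x = unary u (unary v x).
Proof. by rewrite /unary composeE. Qed.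

Lemma unary_diag n (f : op A n) i x : @unary (diag f) i x = f i [ffun _ => x].
Proof.
by rewrite /unary minorE; congr (f i _); apply/ffunP => j; rewrite !ffunE.
Qed.

Lemma unary_image1 u i x : unary u x \in image1 u i.
Proof. exact: imset_f. Qed.

Lemma minor_comp n p q (alpha : 'I_n -> 'I_p) (beta : 'I_p -> 'I_q)
    (f : op A n) :
  minor beta (minor alpha f) = minor (fun i => beta (alpha i)) f.
Proof.
apply: op_ext => i a; rewrite !minorE; congr (f i _).
by apply/ffunP => j; rewrite !ffunE.
Qed.

Lemma minor_compose n p (alpha : 'I_n -> 'I_p) u (f : op A n) :
  minor alpha (compose u f) = compose u (minor alpha f).
Proof. by apply: op_ext => i a; rewrite minorE !composeE minorE. Qed.

Lemma minor_preserves n p (alpha : 'I_n -> 'I_p) (f : op A n) R :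
  preserves f R -> preserves (minor alpha f) R.
Proof.
move=> fR t tR; apply: (in_set_eq (fR (t \o alpha) (fun c => tR (alpha c)))).
apply/ffunP => j; rewrite !ffunE; congr (f _ _).
by apply/ffunP => c; rewrite !ffunE.
Qed.

Lemma compose_preserves n u (f : op A n) R :
  preserves u R -> preserves f R -> preserves (compose u f) R.
Proof.
move=> uR fR t tR; apply: (in_set_eq (uR (fun _ => _) (fun _ => fR t tR))).
apply/ffunP => j; rewrite !ffunE.
by congr (u _ _); apply/ffunP => c; rewrite !ffunE.
Qed.

Lemma unary_preserves u R (t : {dffun forall j : 'I_(arity R), A (rtype j)}) :
  preserves u R -> t \in tuples R ->
  [ffun j => unary u (t j)] \in tuples R.
Proof.
move=> uR tR; apply: (in_set_eq (uR (fun _ => t) (fun _ => tR))).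
apply/ffunP => j; rewrite !ffunE.
by congr (u _ _); apply/ffunP => c; rewrite !ffunE.
Qed.

(** Since [f] takes at least one argument, [R] contains a tuple, and there is only one tuple of
    length 0. *)
Lemma arity0_preserves n (f : op A n.+1) R : arity R = 0 -> preserves f R.
Proof.
move=> R0 t /(_ ord0) /in_set_eq; apply; apply/ffunP => -[j ltj].
by exfalso; rewrite R0 in ltj.
Qed.

Lemma preserves_singleton n (f : op A n) i (a : A i) :
  preserves f (singleton_rel a) -> f i [ffun _ => a] = a.
Proof.
pose t : {dffun forall j : 'I_1, A i} := [ffun _ => a].
have tP : t \in tuples (singleton_rel a) by rewrite inE ffunE.
move=> fR; have := fR (fun _ => t) (fun _ => tP).
rewrite /= inE ffunE /= => /eqP {2}<-.
by congr (f i _); apply/ffunP => c; rewrite !ffunE.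
Qed.

Lemma singleton_preserves n (f : op A n.+1) i (a : A i) :
  Defs.idempotent_op f -> preserves f (singleton_rel a).
Proof.
move=> idf t ta; rewrite /= inE ffunE; apply/eqP; rewrite -[RHS](idf i a).
congr (f i _); apply/ffunP => c; rewrite !ffunE.
by have := ta c; rewrite inE => /eqP.
Qed.

Lemma singleton_small i (a : A i) : small_projections (singleton_rel a).
Proof.
move=> j; apply: (@leq_trans #|[set a]|); last by rewrite cards1.
apply/subset_leq_card/subsetP => x /imsetP[t]; rewrite inE => /eqP ta ->.
by rewrite inE (ord1 j) ta.
Qed.

(** Adding dummy arguments to [e] gives one polymorphism of each arity, and constancy makes this
    choice commute with minors. *)
Lemma const_Pol_trivial (Gamma : relation A -> Prop) (e : op A 1) :
  Pol Gamma e -> (forall i (x y : A i), unary e x = unary e y) ->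
  minion_equiv (Pol Gamma) trivial_clone.
Proof.
move=> ePol e_const; split.
  exists (fun n _ => [ffun _ => [ffun _ => tt]]); split=> // n p alpha f _.
  by apply/ffunP => i; apply/ffunP => a; rewrite [LHS]unitE [RHS]unitE.
exists (fun n _ => minor (fun _ => ord0) e); split=> [n f _ R GR|].
  by apply: minor_preserves; apply: ePol.
move=> n p alpha f _; rewrite minor_comp; apply: op_ext => i a.
rewrite !minorE.
have E (b : 'I_1 -> 'I_p.+1) :
    e i [ffun j => a (b j)] = unary e (a (b ord0)).
  by congr (e i _); apply/ffunP => j; rewrite !ffunE (ord1 j).
rewrite (E (fun=> ord0)) (E (fun=> alpha ord0)); exact: e_const.
Qed.

Lemma arity0_Pol_trivial (Gamma : relation A -> Prop) :
  (forall R, Gamma R -> arity R = 0) ->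
  minion_equiv (Pol Gamma) trivial_clone.
Proof.
move=> G0.
(* The default [a ord0] is never reached: on an empty sort there is no argument [a]. *)
apply: (@const_Pol_trivial _ [ffun i => [ffun a : {ffun 'I_1 -> A i} =>
  if [pick x : A i] is Some x then x else a ord0]]).
  by move=> R /G0; apply: arity0_preserves.
move=> i x y; rewrite /unary !ffunE.
by case: pickP => // /(_ x).
Qed.

(** The equality case is recorded so that equality of the sums over all sorts passes to each single
    sort. *)
Lemma card_image1_compose u e i :
  #|image1 (compose u e) i| <= #|image1 e i| ?= iff
  (#|[set unary u x | x in image1 e i]| == #|image1 e i|).
Proof.
have -> : image1 (compose u e) i = [set unary u x | x in image1 e i].
  by rewrite -imset_comp; apply: eq_imset => x; apply: unary_compose.
by split; first exact: leq_imset_card.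
Qed.

(** Descent on the total size of the images: once no composition lowers the sum, every image keeps
    its size under [u], so [u] is injective on it. *)
Lemma minimal_unary (Gamma : relation A -> Prop) (f : op A 1) :
  Pol Gamma f -> exists2 e : op A 1, Pol Gamma e &
    forall u : op A 1, Pol Gamma u ->
      forall i, {in image1 e i &, injective (@unary u i)}.
Proof.
have [n le_f] := ubnP (\sum_i #|image1 f i|).
elim: n => // n IHn in f le_f * => fPol.
have [|no_drop] := classic (exists2 u : op A 1, Pol Gamma u &
    \sum_i #|image1 (compose u f) i| < \sum_i #|image1 f i|).
  case=> u uPol lt_uf; apply: (IHn (compose u f)).
    exact: leq_trans lt_uf _.
  by move=> R GR; apply: compose_preserves; [apply: uPol | apply: fPol].
exists f => // u uPol i.
have sumE := @leqif_sum _ xpredT _ _ _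
  (fun i _ => card_image1_compose u f i).
have : \sum_i #|image1 (compose u f) i| == \sum_i #|image1 f i|.
  rewrite eqn_leq sumE leqNgt; apply/negP => lt_uf.
  by apply: no_drop; exists u.
by rewrite sumE => /forallP/(_ i)/imset_injP.
Qed.

End Operations.

(** * Making polymorphisms idempotent on the image of [e] *)

Section Idempotent.

Variables (k : nat) (A : 'I_k -> finType) (e : op A 1).

(** A common multiple of all cycle lengths that can occur in any sort; being independent of [f], it
    gives a uniform construction. *)
Definition exponent : nat := (\sum_i #|A i|)`!.

(* If the diagonal [u] of [e o f] permutes the image of [e], then
   [u^(exponent - 1)] inverts it there, whatever [f] is. *)
Definition idempotize n (f : op A n) : op A n :=
  iter exponent.-1 (compose (compose e (diag f))) (compose e f).

Lemma idempotize_Pol (Gamma : relation A -> Prop) n (f : op A n.+1) :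
  Pol Gamma e -> Pol Gamma f -> Pol Gamma (idempotize f).
Proof.
move=> ePol fPol R GR.
have ef := compose_preserves (ePol R GR) (fPol R GR).
have u := compose_preserves (ePol R GR)
  (minor_preserves (fun _ => ord0) (fPol R GR)).
by rewrite /idempotize; elim: _.-1 => //= N; apply: compose_preserves.
Qed.

(** A minor of [f] has the same diagonal as [f], so both sides iterate the same unary operation. *)
Lemma idempotize_minor n p (alpha : 'I_n -> 'I_p) (f : op A n) :
  idempotize (minor alpha f) = minor alpha (idempotize f).
Proof.
have dE: diag (minor alpha f) = diag f by rewrite /diag minor_comp.
rewrite /idempotize dE; elim: _.-1 => [|N IHN] /=.
  by rewrite minor_compose.
by rewrite IHN minor_compose.
Qed.

Lemma idempotize_image n (f : op A n) i a : idempotize f i a \in image1 e i.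
Proof.
rewrite /idempotize; case: _.-1 => [|N] /=; rewrite composeE.
  exact: unary_image1.
by rewrite unary_compose unary_image1.
Qed.

Lemma idempotize_idempotent n (f : op A n) i x :
  {in image1 e i &, injective (@unary _ _ (compose e (diag f)) i)} ->
  x \in image1 e i -> idempotize f i [ffun _ => x] = x.
Proof.
set u := compose e (diag f) => u_inj xS.
have -> : idempotize f i [ffun _ => x] = iter exponent (@unary _ _ u i) x.
  (* On a constant tuple the innermost [compose e f] acts as [u], which supplies the missing
     iteration. *)
  rewrite /idempotize -/u -[in RHS](@prednK exponent (fact_gt0 _)) iterSr.
  elim: _.-1 => [|N IHN] /=; first by rewrite composeE unary_compose unary_diag.
  by rewrite composeE IHN.
have uS: {homo @unary _ _ u i : y / y \in image1 e i}.
  by move=> y _; rewrite unary_compose unary_image1.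
have /dvdnP[d ->] : order (@unary _ _ u i) x %| exponent.
  apply: dvdn_fact; rewrite order_gt0 /=.
  apply: leq_trans (max_card _) _.
  by rewrite (bigD1 i) //= leq_addr.
rewrite iterM; elim: d => //= d ->.
exact: iter_order_in uS u_inj _ xS.
Qed.

End Idempotent.

(** * Restriction to the image of [e], and transfer of operations *)

Section Core.

Variables (k : nat) (A : 'I_k -> finType) (e : op A 1).

Definition large (i : 'I_k) : bool := 1 < #|image1 e i|.

(* A sort on which [e] is constant carries no information; instead of deleting
   it, which would change the types of all relations, it is replaced by a free
   two-element sort. *)
Definition core_set (i : 'I_k) : {set A i + bool} :=
  if large i then inl @: image1 e i else inr @: [set: bool].

Definition core (i : 'I_k) : finType := {x : A i + bool | x \in core_set i}.

(** On large sorts the type of [s] already confines the entries of [t] to the image of [e]. Entries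
    in small sorts are left free, so they constrain no operation. *)
Definition core_rel (R : relation A) : relation core :=
  @Relation k core (arity R) (@rtype _ _ R)
    [set s : {dffun forall j : 'I_(arity R), core (rtype j)} |
      [exists t in tuples R,
        [forall j, large (rtype j) ==> (val (s j) == inl (t j))]]].

Lemma inl_core_set i x : large i -> x \in image1 e i -> inl x \in core_set i.
Proof. by rewrite /core_set => ->; apply: imset_f. Qed.

Lemma inr_core_set i b : ~~ large i -> inr b \in core_set i.
Proof. by rewrite /core_set => /negPf ->; apply: imset_f. Qed.

Lemma core_elt_subproof i (x : A i) :
  (if large i then inl (unary e x) else inr true) \in core_set i.
Proof.
case: ifPn => [Li|]; last exact: inr_core_set.
exact/inl_core_set/unary_image1.
Qed.

Definition core_elt i (x : A i) : core i :=
  exist (fun y => y \in core_set i) _ (core_elt_subproof x).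

Definition left_val i (d : A i) (x : A i + bool) : A i :=
  if x is inl a then a else d.

(** On a large sort the default [a ord0] of [left_val] is never reached; on a small one [e] is
    constant, so any argument gives the same value. *)
Definition of_core n (g : op core n.+1) : op A n.+1 :=
  [ffun i => [ffun a : {ffun 'I_n.+1 -> A i} => unary e
    (if large i
     then left_val (a ord0) (val (g i [ffun c => core_elt (a c)]))
     else a ord0)]].

Lemma card_core i : #|core i| = if large i then #|image1 e i| else 2.
Proof.
rewrite card_sig (eq_card (B := core_set i)) // /core_set.
case: ifP => _; rewrite card_imset ?cardsT ?card_bool //.
  by move=> x y [].
by move=> x y [].
Qed.

Lemma small_const i (x y : A i) : ~~ large i -> unary e x = unary e y.
Proof.
by rewrite -leqNgt => /card_le1_eqP; apply; apply: unary_image1.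
Qed.

Lemma core_large i (b : core i) :
  large i -> exists2 a, a \in image1 e i & val b = inl a.
Proof.
move=> Li; move: (val b) (valP b) => v.
by rewrite /core_set Li => /imsetP[a]; exists a.
Qed.

Lemma core_small i (b : core i) : ~~ large i -> exists a, val b = inr a.
Proof.
move=> /negPf Si; move: (val b) (valP b) => v.
by rewrite /core_set Si => /imsetP[a _ ->]; exists a.
Qed.

Lemma core_relP (R : relation A)
    (s : {dffun forall j : 'I_(arity R), core (rtype j)}) :
  reflect (exists2 t, t \in tuples R &
             forall j, large (rtype j) -> val (s j) = inl (t j))
          (s \in tuples (core_rel R)).
Proof.
rewrite inE; apply: (iffP exists_inP) => -[t tR st]; exists t => //.
  by move=> j Lj; have /forallP/(_ j) := st; rewrite Lj => /eqP.
by apply/forallP => j; apply/implyP => Lj; apply/eqP/st.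
Qed.

Lemma core_rel_small R : small_projections R -> small_projections (core_rel R).
Proof.
move=> Rsmall j /=; have [Lj|Sj] := boolP (large (rtype j)); last first.
  by apply: leq_trans (max_card _) _; rewrite card_core (negPf Sj).
apply: leq_trans (Rsmall j).
rewrite -(card_imset _ val_inj).
have inl_inj : injective (@inl (A (rtype j)) bool) by move=> x y [].
rewrite -[leqRHS](card_imset _ inl_inj).
apply/subset_leq_card/subsetP => _ /imsetP[_ /imsetP[s sR ->] ->].
have /core_relP[t tR /(_ j Lj) ->] := sR.
by do 2!apply: imset_f.
Qed.

(** Preservation by [g] yields a tuple [t'] of [R] that is right on large sorts only. Applying [e]
    to all of [t'] stays in [R] and corrects the small sorts, where [e] is constant; hence the outer
    [e] in [of_core]. *)
Lemma of_core_preserves n (g : op core n.+1) R :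
  preserves e R -> preserves g (core_rel R) -> preserves (of_core g) R.
Proof.
move=> eR gR t tR.
pose s c : {dffun forall j : 'I_(arity R), core (rtype j)} :=
  [ffun j => core_elt (t c j)].
have sR c : s c \in tuples (core_rel R).
  apply/core_relP; exists [ffun j => unary e (t c j)] => [|j Lj].
    exact: unary_preserves.
  by rewrite !ffunE /= Lj.
have /core_relP[t' t'R gt'] := gR s sR.
apply: (in_set_eq (unary_preserves eR t'R)).
apply/ffunP => j; rewrite !ffunE.
case: ifPn => [Lj|Sj]; last exact: small_const.
have := gt' j Lj; rewrite !ffunE => gt'j.
set gs := g _ _; have -> : val gs = inl (t' j) => //.
rewrite -gt'j /gs; congr (val (g _ _)).
by apply/ffunP => c; rewrite !ffunE.
Qed.

Lemma of_coreE n (g : op core n.+1) i a :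
  of_core g i a = unary e
    (if large i then left_val (a ord0) (val (g i [ffun c => core_elt (a c)]))
     else a ord0).
Proof. by rewrite !ffunE. Qed.

Lemma of_core_minor n p (alpha : 'I_n.+1 -> 'I_p.+1) (g : op core n.+1) :
  of_core (minor alpha g) = minor alpha (of_core g).
Proof.
apply: op_ext => i a; rewrite minorE !of_coreE.
case: ifPn => [Li|Si]; last exact: small_const.
rewrite minorE; set b := [ffun _ => _]; set b' := [ffun _ => core_elt _].
have -> : b = b' by apply/ffunP => c; rewrite !ffunE.
by have [x _ ->] := core_large (g i b') Li.
Qed.

Variables (i0 : 'I_k) (p q : A i0).

(* On a small sort, an idempotent operation on [{p, q}] is simulated by
   testing whether [h] returns [p]. *)
Definition to_core n (h : op A n.+1) : op core n.+1 :=
  [ffun i => [ffun b : {ffun 'I_n.+1 -> core i} => insubd (b ord0)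
    (match val (b ord0) with
     | inl d => inl (h i [ffun c => left_val d (val (b c))])
     | inr _ => inr (h i0 [ffun c => if val (b c) == inr true
                                     then p else q] == p)
     end)]].

Lemma to_core_large n (h : op A n.+1) i (b : {ffun 'I_n.+1 -> core i})
    (t : {ffun 'I_n.+1 -> A i}) :
  large i -> h i t \in image1 e i -> (forall c, val (b c) = inl (t c)) ->
  val (to_core h i b) = inl (h i t).
Proof.
move=> Li hS bt; rewrite !ffunE bt.
have -> : [ffun c => left_val (t ord0) (val (b c))] = t.
  by apply/ffunP => c; rewrite ffunE bt.
by rewrite insubdK //; apply: inl_core_set.
Qed.

Lemma to_core_small n (h : op A n.+1) i (b : {ffun 'I_n.+1 -> core i}) :
  ~~ large i -> val (to_core h i b) =
    inr (h i0 [ffun c => if val (b c) == inr true then p else q] == p).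
Proof.
move=> Si; rewrite !ffunE; have [a ->] := core_small (b ord0) Si.
by rewrite insubdK //; apply: inr_core_set.
Qed.

Lemma core_tuple n i (b : {ffun 'I_n.+1 -> core i}) :
  large i -> exists t : {ffun 'I_n.+1 -> A i}, forall c, val (b c) = inl (t c).
Proof.
move=> Li; have [d _ _] := core_large (b ord0) Li.
exists [ffun c => left_val d (val (b c))] => c; rewrite ffunE.
by have [a _ ->] := core_large (b c) Li.
Qed.

(** The fallback [b ord0] of [insubd] could change under a minor; it is never reached because [h]
    takes values in the image of [e]. *)
Lemma to_core_minor n r (alpha : 'I_n.+1 -> 'I_r.+1) (h : op A n.+1) :
  (forall i a, h i a \in image1 e i) ->
  to_core (minor alpha h) = minor alpha (to_core h).
Proof.
move=> hS; apply: op_ext => i b; apply: val_inj; rewrite minorE.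
have [Li|Si] := boolP (large i).
  have [t bt] := core_tuple b Li.
  rewrite (to_core_large _ _ bt) ?minorE //.
  rewrite (@to_core_large _ h _ _ [ffun j => t (alpha j)]) // => c.
  by rewrite !ffunE.
rewrite !to_core_small // minorE; congr (inr (h i0 _ == p)).
by apply/ffunP => c; rewrite !ffunE.
Qed.

Lemma to_core_preserves n (h : op A n.+1) R :
  (forall i a, h i a \in image1 e i) ->
  preserves h R -> preserves (to_core h) (core_rel R).
Proof.
move=> hS hR s sR.
have wit c : exists t, (t \in tuples R) &&
    [forall j, large (rtype j) ==> (val (s c j) == inl (t j))].
  by have /core_relP[t tR st] := sR c; exists t; rewrite tR;
    apply/forallP => j; apply/implyP => Lj; apply/eqP/st.
(* Witnesses are chosen column by column; their entries in small sorts are arbitrary, which is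
   harmless as [core_rel] ignores them. *)
pose t c := xchoose (wit c).
have tR c : t c \in tuples R by have /andP[] := xchooseP (wit c).
apply/core_relP; exists [ffun j => h (rtype j) [ffun c => t c j]].
  exact: hR t tR.
move=> j Lj; rewrite [in RHS]ffunE -(@to_core_large _ h _ [ffun c => s c j]) //.
  by congr val; apply: ffunE.
move=> c; rewrite !ffunE; have /andP[_ /forallP/(_ j)] := xchooseP (wit c).
by rewrite Lj => /eqP.
Qed.

Lemma to_core_idempotent n (h : op A n.+1) :
  p != q -> p \in image1 e i0 -> q \in image1 e i0 ->
  (forall i x, x \in image1 e i -> h i [ffun _ => x] = x) ->
  Defs.idempotent_op (to_core h).
Proof.
move=> neq_pq pS qS hid i b; apply: val_inj.
have [Li|Si] := boolP (large i).
  have [a aS ba] := core_large b Li.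
  rewrite (@to_core_large _ h _ _ [ffun _ => a]) ?hid //.
  by move=> c; rewrite !ffunE.
rewrite to_core_small //; have [a ba] := core_small b Si; rewrite ba.
(* The bit [a] is encoded as [p] or [q], returned unchanged by [h], and decoded correctly because
   [p != q]. *)
have -> : [ffun c : 'I_n.+1 => if val ([ffun _ : 'I_n.+1 => b] c) == inr true
            then p else q] = [ffun _ => if a then p else q].
  by apply/ffunP => c; rewrite !ffunE ba; case: a {ba}.
by case: a {ba}; rewrite hid ?eqxx // eq_sym (negPf neq_pq).
Qed.

End Core.

(** * Choice of [Delta] and verification *)

Theorem theorem3p1 (k : nat) (A : 'I_k -> finType) (m : nat)
    (Gamma : relation A -> Prop)
    (Gamma_arity : forall R : relation A, Gamma R -> arity R <= m)
    (Pol_nontrivial : ~ minion_equiv (Pol Gamma) trivial_clone) :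
  exists (l : nat) (B : 'I_l -> finType) (Delta : relation B -> Prop),
    (forall R : relation B, Delta R -> arity R <= m) /\
    minion_equiv (Pol Gamma) (Pol_id Delta) /\
    (forall (n : nat) (f : op B n.+1), Pol_id Delta f <-> Pol Delta f) /\
    (forall i : 'I_l, 1 < #|B i| <= \max_(j < k) #|A j|) /\
    ((forall R : relation A, Gamma R -> small_projections R) ->
     forall R : relation B, Delta R -> small_projections R).
Proof.
(* This leaves room for the singleton relations, which have arity 1. *)
have m_gt0 : 0 < m.
  rewrite lt0n; apply/eqP => m0; apply/Pol_nontrivial/arity0_Pol_trivial.
  by move=> R /Gamma_arity; rewrite m0 leqn0 => /eqP.
(* The identity is the starting point of the descent. *)
have proj_Pol : Pol Gamma ([ffun i => [ffun a : {ffun 'I_1 -> A i} => a ord0]]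
    : op A 1).
  move=> R _ t /(_ ord0) /in_set_eq; apply; apply/ffunP => j.
  by rewrite !ffunE.
have [e ePol e_min] := minimal_unary proj_Pol.
have [i0 Li0] : exists i0, large e i0.
  apply/existsP; apply/negP => /existsP no_large; apply: Pol_nontrivial.
  apply: (const_Pol_trivial ePol) => i x y; apply: small_const.
  by apply/negP => Li; apply: no_large; exists i.
have /card_gt1P[p [q [pS qS neq_pq]]] := Li0.
pose Delta (R : relation (core e)) : Prop :=
  (exists2 S, Gamma S & R = core_rel e S) \/
  (exists i (a : core e i), R = singleton_rel a).
have Pol_idE n (f : op (core e) n.+1) : Pol Delta f -> Defs.idempotent_op f.
  by move=> fPol i a; apply/preserves_singleton/fPol; right; exists i, a.
exists k, (core e), Delta; split; [|split; [split|split; [|split]]].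
- by move=> R [[S GS ->] | [i [a ->]]] //=; apply: Gamma_arity.
- exists (fun n f => to_core e p q (idempotize e f)); split=> [n f fPol|].
    have idf: Defs.idempotent_op (to_core e p q (idempotize e f)).
      apply: to_core_idempotent => // i x; apply: idempotize_idempotent.
      apply: e_min => R GR; apply: compose_preserves; first exact: ePol.
      by apply: minor_preserves; apply: fPol.
    split=> // R [[S GS ->] | [i [a ->]]]; last exact: singleton_preserves.
    apply: to_core_preserves => [i a|]; first exact: idempotize_image.
    exact: idempotize_Pol GS.
  move=> n r alpha f _; rewrite idempotize_minor to_core_minor // => i a.
  exact: idempotize_image.
- exists (fun n g => of_core g); split=> [n g [gPol _] R GR|].
    apply: of_core_preserves; first exact: ePol.
    by apply: gPol; left; exists R.
  by move=> n r alpha g _; apply: of_core_minor.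
- by move=> n f; split=> [[] | fPol] //; split=> //; apply: Pol_idE.
- move=> i; have le_max j : #|image1 e j| <= \max_(j < k) #|A j|.
    exact: leq_trans (max_card _) (leq_bigmax j).
  rewrite card_core; case: ifP => [Li | _]; first by apply/andP; split.
  (* A free sort has two elements, no more than the image of [e] in the large sort [i0]. *)
  exact: leq_trans Li0 (le_max i0).
- move=> Gsmall R [[S GS ->] | [i [a ->]]]; last exact: singleton_small.
  by apply: core_rel_small; apply: Gsmall.
Qed.
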